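(* Let $n\ge1$ and let $\psi:\mathbb{R}^+\to\mathbb{R}^+$ be a non-increasing function such that $\psi(|g|)=o\big(|g|^{-\frac{n+1}{n}}\big)$ and such that $\lambda_\psi=\liminf_{|g|\to\infty}\frac{-\log\psi(|g|)}{\log|g|}<\infty$. Then $\operatorname{Exact}(\psi)\neq\emptyset$.
   Context: Let $\mathcal{K}=\mathbb{F}_q((X^{-1}))$ with the absolute value determined by $|f/g|=e^{\deg f-\deg g}$ for nonzero $f,g\in\mathbb{F}_q[X]$, and $\mathbb{Z}_{\mathcal O}=\{x\in\mathcal{K}:|x|\le1\}$. For $x\in\mathcal{K}^n$, $\|x\|=\max_i|x_i|$. The set $\operatorname{Exact}(\psi)$ is the set of $x\in\mathbb{Z}_{\mathcal O}^n$ such that (1) $\|x-\frac{f}{g}\|=\psi(|g|)$ for infinitely many pairs $(f,g)\in\mathbb{F}_q[X]^n\times(\mathbb{F}_q[X]\setminus\{0\})$, and (2) there is $g_0\in\mathbb{F}_q[X]$ such that $\|x-\frac fg\|\ge\psi(|g|)$ for all $(f,g)\in\mathbb{F}_q[X]^n\times\mathbb{F}_q[X]$ with $|g|\ge|g_0|$.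
   Formalization: Adds the hypothesis that ψ(|g|) is a value of the absolute value of K for polynomials g of arbitrarily large |g|; without it the claim fails (e.g. ψ(r)=e^{1/2}r^{-3}), and it is necessary for Exact(ψ) to be nonempty. *)

(* Defs.v *)
From HB Require Import structures.
From mathcomp Require Import all_boot all_order all_algebra.
From mathcomp Require Import zify.
From mathcomp Require Import all_classical all_reals all_analysis.

Set Implicit Arguments.
Unset Strict Implicit.
Unset Printing Implicit Defensive.

Import Order.TTheory GRing.Theory Num.Theory.
Import numFieldNormedType.Exports.

Local Open Scope classical_set_scope.
Local Open Scope ring_scope.

(* An element of F((X^-1)) is a series \sum_i x_i X^i, indexed by int, with   *)
(* finitely many nonzero coefficients of positive index; [lcoef x i] is the   *)
(* coefficient of X^i.                                                        *)
Record laurent (F : fieldType) := Laurent {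
  lcoef :> int -> F ;
  lcoef_bounded : exists N : int, forall i, N < i -> lcoef i = 0 }.

Section LaurentField.
Variable F : fieldType.
Implicit Types (x y z : laurent F) (i j N M : int).

HB.instance Definition _ := gen_eqMixin (laurent F).
HB.instance Definition _ := gen_choiceMixin (laurent F).

Definition ldeg_le x N := forall i, N < i -> x i = 0.

Lemma laurentP x y : (forall i, x i = y i) -> x = y.
Proof.
case: x y => [x xb] [y yb] /= /funext exy; subst y.
by congr Laurent; exact: Prop_irrelevance.
Qed.

Fact laurent0_bounded : exists N, forall i, N < i -> (fun=> 0 : F) i = 0.
Proof. by exists 0. Qed.
Definition laurent0 := Laurent laurent0_bounded.

Fact laurentN_bounded x : exists N, forall i, N < i -> (fun i => - x i) i = 0.
Proof. by have [N xN] := lcoef_bounded x; exists N => i /xN ->; rewrite oppr0. Qed.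
Definition laurentN x := Laurent (laurentN_bounded x).

Fact laurentD_bounded x y :
  exists N, forall i, N < i -> (fun i => x i + y i) i = 0.
Proof.
have [[N xN] [M yM]] := (lcoef_bounded x, lcoef_bounded y).
by exists (Num.max N M) => i; rewrite gt_max => /andP[/xN -> /yM ->]; rewrite addr0.
Qed.
Definition laurentD x y := Laurent (laurentD_bounded x y).

Fact laurentDA : associative laurentD.
Proof. by move=> x y z; apply: laurentP => i /=; rewrite addrA. Qed.
Fact laurentDC : commutative laurentD.
Proof. by move=> x y; apply: laurentP => i /=; rewrite addrC. Qed.
Fact laurent0D : left_id laurent0 laurentD.
Proof. by move=> x; apply: laurentP => i /=; rewrite add0r. Qed.
Fact laurentND : left_inverse laurent0 laurentN laurentD.
Proof. by move=> x; apply: laurentP => i /=; rewrite addNr. Qed.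

HB.instance Definition _ :=
  GRing.isZmodule.Build (laurent F) laurentDA laurentDC laurent0D laurentND.

Lemma lcoef0 i : (0 : laurent F) i = 0. Proof. by []. Qed.
Lemma lcoefN x i : (- x) i = - x i. Proof. by []. Qed.
Lemma lcoefD x y i : (x + y) i = x i + y i. Proof. by []. Qed.
Lemma lcoefB x y i : (x - y) i = x i - y i. Proof. by []. Qed.

(* The sum has finite support by [lcoef_bounded]. *)
Definition lconv x y (n : int) : F := \sum_(i \in [set: int]) x i * y (n - i).

Lemma lconv_sum x y N M (j : nat) : ldeg_le x N -> ldeg_le y M ->
  lconv x y (N + M - j%:Z) =
  \sum_(k < j.+1) x (N - k%:Z) * y (M - (j - k)%N%:Z).
Proof.
move=> xN yM; rewrite /lconv.
pose h (k : nat) : int := N - k%:Z.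
rewrite -(fsbig_widen (h @` `I_j.+1)) //=; last first.
  move=> i [_ /= hi]; case: (ltP N i) => [/xN ->|iN]; first by rewrite mul0r.
  rewrite (yM (N + M - j%:Z - i)) ?mulr0 //.
  rewrite ltNge; apply/negP => le; apply: hi; exists `|N - i|%N; rewrite /h /=; lia.
rewrite fsbig_image; last by move=> a b _ _; rewrite /h; lia.
rewrite -fsbig_ord; apply: eq_bigr => k _; rewrite /h.
by congr (_ * y _); have := ltn_ord k; lia.
Qed.

Lemma lconv_gt x y N M i : ldeg_le x N -> ldeg_le y M -> N + M < i ->
  lconv x y i = 0.
Proof.
move=> xN yM lt; apply: fsbig1 => k _; case: (ltP N k) => [/xN ->|kN].
  by rewrite mul0r.
by rewrite (yM (i - k)) ?mulr0 //; lia.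
Qed.

Fact lconv_bounded x y : exists N, forall i, N < i -> lconv x y i = 0.
Proof.
have [[N xN] [M yM]] := (lcoef_bounded x, lcoef_bounded y).
by exists (N + M) => i; exact: lconv_gt.
Qed.
Definition laurentM x y := Laurent (lconv_bounded x y).

Fact laurent1_bounded :
  exists N, forall i, N < i -> (fun i : int => (i == 0)%:R : F) i = 0.
Proof. by exists 0 => i; case: eqP => // ->; rewrite ltxx. Qed.
Definition laurent1 := Laurent laurent1_bounded.

(* The terms of indices N, N - 1, ..., N - L + 1 of x as a polynomial in X^-1. *)
Let tr x N L : {poly F} := \poly_(k < L) x (N - k%:Z).

Let coefM_eq (p q p' q' : {poly F}) (j : nat) :
  (forall k, (k <= j)%N -> p`_k = p'`_k) ->
  (forall k, (k <= j)%N -> q`_k = q'`_k) -> (p * q)`_j = (p' * q')`_j.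
Proof.
move=> pp qq; rewrite !coefM; apply: eq_bigr => k _.
by rewrite pp ?qq ?leq_subr // -ltnS.
Qed.

Let mul_tr x y N M L (j : nat) : ldeg_le x N -> ldeg_le y M -> (j < L)%N ->
  laurentM x y (N + M - j%:Z) = (tr x N L * tr y M L)`_j.
Proof.
move=> xN yM jL; rewrite /= (lconv_sum _ xN yM) coefM; apply: eq_bigr => k _.
have kj := ltn_ord k; rewrite !coef_poly !ifT //; lia.
Qed.

Let mul_bound x y N M : ldeg_le x N -> ldeg_le y M ->
  ldeg_le (laurentM x y) (N + M).
Proof. by move=> xN yM i; exact: lconv_gt. Qed.

Let laurent_eq_le x y N : ldeg_le x N -> ldeg_le y N ->
  (forall j : nat, x (N - j%:Z) = y (N - j%:Z)) -> x = y.
Proof.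
move=> xN yN e; apply: laurentP => i; case: (ltP N i) => [lt|le].
  by rewrite xN ?yN.
by have -> : i = N - `|N - i|%N%:Z by lia.
Qed.

Fact laurentMC : commutative laurentM.
Proof.
move=> x y; have [[N xN] [M yM]] := (lcoef_bounded x, lcoef_bounded y).
apply: (@laurent_eq_le _ _ (N + M)); first exact: mul_bound.
  by rewrite addrC; exact: mul_bound.
move=> j; rewrite (@mul_tr x y N M j.+1) // mulrC.
by rewrite -(@mul_tr y x M N j.+1) // [M + N]addrC.
Qed.

Fact laurentMA : associative laurentM.
Proof.
move=> x y z.
have [[[N xN] [M yM]] [P zP]] :=
  (lcoef_bounded x, lcoef_bounded y, lcoef_bounded z).
have xyb := mul_bound xN yM; have yzb := mul_bound yM zP.
have e : N + (M + P) = N + M + P by rewrite addrA.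
apply: (@laurent_eq_le _ _ (N + M + P)).
- by rewrite -e; exact: mul_bound.
- exact: mul_bound.
move=> j; rewrite (@mul_tr (laurentM x y) z (N + M) P j.+1) // -e.
rewrite (@mul_tr x (laurentM y z) N (M + P) j.+1) //.
transitivity ((tr x N j.+1 * (tr y M j.+1 * tr z P j.+1))`_j).
  by apply: coefM_eq => // k kj; rewrite coef_poly ltnS kj (@mul_tr _ _ _ _ j.+1).
rewrite mulrA.
by apply: coefM_eq => // k kj; rewrite [RHS]coef_poly ltnS kj (@mul_tr _ _ _ _ j.+1).
Qed.

Fact laurent1M : left_id laurent1 laurentM.
Proof.
move=> x; have [N xN] := lcoef_bounded x.
have b1 : ldeg_le laurent1 0 by move=> i /=; case: eqP => // ->; rewrite ltxx.
apply: (@laurent_eq_le _ _ (0 + N)); first exact: mul_bound.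
  by rewrite add0r.
move=> j; rewrite (@mul_tr _ _ _ _ j.+1) //.
transitivity ((1 * tr x N j.+1)`_j).
  apply: coefM_eq => // k kj; rewrite coef_poly ltnS kj /= coef1.
  by congr (_%:R); lia.
by rewrite mul1r coef_poly ltnSn add0r.
Qed.

Fact laurentMDl : left_distributive laurentM +%R.
Proof.
move=> x y z.
have [[[N xN] [M yM]] [P zP]] :=
  (lcoef_bounded x, lcoef_bounded y, lcoef_bounded z).
pose Q := Num.max N M.
have xQ : ldeg_le x Q by move=> i; rewrite gt_max => /andP[/xN].
have yQ : ldeg_le y Q by move=> i; rewrite gt_max => /andP[_ /yM].
have xyQ : ldeg_le (x + y) Q by move=> i iQ; rewrite lcoefD xQ ?yQ ?addr0.
apply: (@laurent_eq_le _ _ (Q + P)); first exact: mul_bound.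
  by move=> i iQ; rewrite lcoefD !(mul_bound _ zP iQ) ?addr0.
move=> j; rewrite lcoefD !(@mul_tr _ _ _ _ j.+1) // -coefD -mulrDl.
by apply: coefM_eq => // k kj; rewrite coefD !coef_poly ltnS kj.
Qed.

Fact laurent1_neq0 : laurent1 != 0.
Proof.
apply/eqP => /(congr1 (fun x : laurent F => x 0)) /= /eqP.
by rewrite oner_eq0.
Qed.

HB.instance Definition _ := GRing.Zmodule_isComNzRing.Build (laurent F)
  laurentMA laurentMC laurent1M laurentMDl laurent1_neq0.

Lemma lcoef1 i : (1 : laurent F) i = (i == 0)%:R. Proof. by []. Qed.

Lemma lcoefM x y (n : int) :
  (x * y) n = \sum_(i \in [set: int]) x i * y (n - i).
Proof. by []. Qed.

Lemma lcoefM_sum x y N M (j : nat) : ldeg_le x N -> ldeg_le y M ->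
  (x * y) (N + M - j%:Z) =
  \sum_(k < j.+1) x (N - k%:Z) * y (M - (j - k)%N%:Z).
Proof. exact: lconv_sum. Qed.

Lemma ldeg_leM x y N M : ldeg_le x N -> ldeg_le y M -> ldeg_le (x * y) (N + M).
Proof. exact: mul_bound. Qed.

Lemma laurent_top x : x != 0 -> exists2 N, x N != 0 & ldeg_le x N.
Proof.
move=> x0; have [M xM] := lcoef_bounded x.
have ex : exists k : nat, x (M - k%:Z) != 0.
  apply: contrapT => nex; case/eqP: x0; apply: (@laurent_eq_le _ _ M) => // j.
  by apply/eqP; apply: contrapT => /negP xj; apply: nex; exists j.
case: (ex_minnP ex) => m xm min; exists (M - m%:Z) => // i lt.
case: (ltP M i) => [/xM//|le]; apply/eqP; apply: contrapT => /negP xi.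
have := min `|M - i|%N.
have -> : M - `|M - i|%N%:Z = i by lia.
by move/(_ xi); lia.
Qed.

Let inv_seq (a : nat -> F) := fix inv_seq (n : nat) : seq F :=
  if n is m.+1 then
    rcons (inv_seq m) ((a 0%N)^-1 *
      ((m == 0%N)%:R - \sum_(k < m) a (m - k)%N * (inv_seq m)`_k))
  else [::].

Let inv_seqP (a : nat -> F) : a 0%N != 0 ->
  exists b : nat -> F, forall j : nat,
    \sum_(k < j.+1) a k * b (j - k)%N = (j == 0%N)%:R.
Proof.
move=> a0; pose b n := (inv_seq a n.+1)`_n; exists b => j.
have sz n : size (inv_seq a n) = n by elim: n => //= n IH; rewrite size_rcons IH.
have nthE n m : (n < m)%N -> (inv_seq a m)`_n = b n.
  elim: m => // m IH; rewrite ltnS leq_eqVlt => /predU1P[->//|nm].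
  by rewrite [LHS]/= nth_rcons sz nm IH.
have bE : a 0%N * b j = (j == 0%N)%:R - \sum_(k < j) a (j - k)%N * b k.
  rewrite {1}/b /= nth_rcons sz ltnn eqxx mulVKf //; congr (_ - _).
  by apply: eq_bigr => k _; rewrite nthE.
rewrite big_ord_recl subn0 bE [X in _ + X](reindex_inj rev_ord_inj) /=.
rewrite [X in _ + X](eq_bigr (fun k : 'I_j => a (j - k)%N * b k)) ?subrK //.
move=> k _; have kj := ltn_ord k; rewrite /bump /=.
by congr (a _ * b _); lia.
Qed.

Lemma laurent_invertible x : x != 0 -> exists y, x * y = 1.
Proof.
move=> /laurent_top[N xN0 xN].
have [|b bE] := @inv_seqP (fun k => x (N - k%:Z)).
  by rewrite subr0.
pose c i : F := if i <= - N then b `|- N - i|%N else 0.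
have cb : exists M, forall i, M < i -> c i = 0.
  by exists (- N) => i; rewrite /c leNgt => ->.
pose y := Laurent cb.
have yN : ldeg_le y (- N) by move=> i; rewrite /= /c leNgt => ->.
exists y; have e0 : N + - N = 0 by rewrite subrr.
apply: (@laurent_eq_le _ _ (N + - N)); first exact: ldeg_leM.
  by rewrite e0 => i; rewrite lcoef1; case: eqP => // ->; rewrite ltxx.
move=> j; rewrite lcoefM_sum // e0 lcoef1.
transitivity (\sum_(k < j.+1) x (N - k%:Z) * b (j - k)%N).
  apply: eq_bigr => k _; congr (_ * _); rewrite /= /c ifT; last by lia.
  by congr b; lia.
by rewrite bE; congr (_%:R); lia.
Qed.

Definition laurentV x : laurent F := xget 0 [set y | y * x = 1].

Fact laurentVM x : x != 0 -> laurentV x * x = 1.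
Proof.
move=> /laurent_invertible[y xy]; rewrite /laurentV.
by case: xgetP => [z _ //|/(_ y)]; case; rewrite /= mulrC.
Qed.

Fact laurentV0 : laurentV 0 = 0.
Proof.
rewrite /laurentV; case: xgetP => // z _ /eqP /=.
by rewrite mulr0 eq_sym oner_eq0.
Qed.

HB.instance Definition _ :=
  GRing.ComNzRing_isField.Build (laurent F) laurentVM laurentV0.

Fact poly_laurent_bounded (p : {poly F}) :
  exists N, forall i, N < i -> (fun i => if i is Posz n then p`_n else 0) i = 0.
Proof.
exists (size p)%:Z => -[n|//]; rewrite ltz_nat => lt.
by rewrite nth_default // ltnW.
Qed.
Definition poly_laurent (p : {poly F}) : laurent F :=
  Laurent (poly_laurent_bounded p).

Lemma poly_laurent_ldeg_le (p : {poly F}) (m : nat) :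
  (size p <= m.+1)%N -> ldeg_le (poly_laurent p) m%:Z.
Proof.
move=> sp [n|//]; rewrite ltz_nat => lt /=.
by rewrite nth_default // (leq_trans sp).
Qed.

Fact poly_laurent_is_zmod_morphism : zmod_morphism poly_laurent.
Proof.
by move=> p q; apply: laurentP => -[n|n]; rewrite lcoefB /= ?coefB ?subr0.
Qed.

Fact poly_laurent_is_monoid_morphism : monoid_morphism poly_laurent.
Proof.
split; first by apply: laurentP => -[n|n] //; rewrite lcoef1 /= coef1.
move=> p q; apply: laurentP => -[n|n]; rewrite lcoefM; last first.
  rewrite fsbig1 // => -[k|k] _; last by rewrite mul0r.
  have -> : Negz n - k%:Z = Negz (n + k) by lia.
  by rewrite mulr0.
rewrite -(fsbig_widen (Posz @` `I_n.+1)) //=; last first.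
  move=> [k|k] [_ /= hk]; rewrite ?mul0r //.
  have -> : n%:Z - k%:Z = Negz (k - n).-1.
    suff : (n < k)%N by lia.
    by rewrite ltnNge; apply/negP => kn; apply: hk; exists k.
  by rewrite mulr0.
rewrite fsbig_image; last by move=> a b _ _ [].
rewrite -fsbig_ord coefM; apply: eq_bigr => k _ /=.
by have -> : n%:Z - k%:Z = (n - k)%N%:Z by have := ltn_ord k; lia.
Qed.

HB.instance Definition _ := GRing.isZmodMorphism.Build
  {poly F} (laurent F) poly_laurent poly_laurent_is_zmod_morphism.
HB.instance Definition _ := GRing.isMonoidMorphism.Build
  {poly F} (laurent F) poly_laurent poly_laurent_is_monoid_morphism.

(* The largest index of a nonzero coefficient; ldeg 0 = 0 is a junk value. *)
Definition ldeg x : int := xget 0 [set N | x N != 0 /\ ldeg_le x N].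

Lemma ldegE x N : x N != 0 -> ldeg_le x N -> ldeg x = N.
Proof.
move=> xN bN; rewrite /ldeg; case: xgetP => [M _ [xM bM]|/(_ N)]; last by case.
by apply/eqP; case: ltgtP => // [/bM e|/bN e]; rewrite e eqxx in xN xM.
Qed.

End LaurentField.

Section AbsoluteValue.
Variables (R : realType) (F : fieldType).
Implicit Types (x y : laurent F) (f g : {poly F}).

Definition labs x : R := if x == 0 then 0 else expR (ldeg x)%:~R.

Lemma labs0 : labs 0 = 0. Proof. by rewrite /labs eqxx. Qed.

Lemma labsM x y : labs (x * y) = labs x * labs y.
Proof.
have [->|x0] := eqVneq x 0; first by rewrite mul0r labs0 mul0r.
have [->|y0] := eqVneq y 0; first by rewrite mulr0 labs0 mulr0.
rewrite /labs mulf_eq0 !ifF ?(negbTE x0) ?(negbTE y0) // -expRD -intrD.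
have [[N xN bN] [M yM bM]] := (laurent_top x0, laurent_top y0).
rewrite (ldegE xN bN) (ldegE yM bM) (@ldegE _ _ (N + M)) //; last exact: ldeg_leM.
rewrite -[N + M]subr0 lcoefM_sum // big_ord1 !subr0.
by rewrite mulf_neq0.
Qed.

Lemma labs_poly f : f != 0 -> labs (poly_laurent f) = expR (size f).-1%:R.
Proof.
move=> f0; have lf : poly_laurent f (size f).-1%:Z != 0.
  by rewrite /= -/(lead_coef f) lead_coef_eq0.
have fn0 : poly_laurent f != 0.
  by apply: contraNneq lf => ->.
rewrite /labs (negbTE fn0) (ldegE lf) //.
by apply: poly_laurent_ldeg_le; rewrite prednK // size_poly_gt0.
Qed.

(* The formula |f/g| = e^(deg f - deg g) which determines the absolute value. *)
Lemma labs_frac f g : f != 0 -> g != 0 ->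
  labs (poly_laurent f / poly_laurent g) =
  expR ((size f).-1%:R - (size g).-1%:R).
Proof.
move=> f0 g0; rewrite expRD expRN -!labs_poly //.
have gn0 : labs (poly_laurent g) != 0 by rewrite labs_poly // gt_eqF ?expR_gt0.
apply: (mulIf gn0); rewrite -labsM divfK ?divfK //.
by apply: contraNneq gn0 => ->; rewrite labs0.
Qed.

Definition pabs g : R := labs (poly_laurent g).

Definition lnorm n (x : 'rV[laurent F]_n) : R :=
  \big[Num.max/0]_(i < n) labs (x 0 i).

(* The vector f/g, where a zero denominator is excluded at each use. *)
Definition ratvec n (f : 'rV[{poly F}]_n) g : 'rV[laurent F]_n :=
  \row_i (poly_laurent (f 0 i) / poly_laurent g).

Definition Exact n (psi : R -> R) : set 'rV[laurent F]_n :=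
  [set x : 'rV[laurent F]_n | [/\ forall i, labs (x 0 i) <= 1,
    infinite_set [set fg : 'rV[{poly F}]_n * {poly F} |
      fg.2 != 0 /\ lnorm (x - ratvec fg.1 fg.2) = psi (pabs fg.2)] &
    exists g0 : {poly F}, forall (f : 'rV[{poly F}]_n) (g : {poly F}),
      g != 0 -> pabs g0 <= pabs g -> psi (pabs g) <= lnorm (x - ratvec f g)]].

(* The filter of |g| --> oo as g ranges over F[X], pushed forward to R. *)
Definition pabs_oo : set_system R := within (range pabs) +oo.

Global Instance pabs_oo_filter : Filter pabs_oo.
Proof. exact: within_filter. Qed.

Canonical pabs_oo_filter_on := FilterType pabs_oo pabs_oo_filter.

Definition lambda_ (psi : R -> R) : \bar R :=
  limf_einf (fun r => (- ln (psi r) / ln r)%:E) pabs_oo.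

(* [labs] only takes the values 0 and e^k with k an integer, so equality      *)
(* ||x - f/g|| = psi(|g|) can only hold when psi(|g|) is such a value. This   *)
(* condition is therefore necessary for [Exact F n psi] to be nonempty, see   *)
(* [Exact_attains_value] below; psi(r) = e^(1/2) r^-3 violates it.            *)
Definition attains_values (psi : R -> R) :=
  forall r : R, exists g : {poly F}, [/\ g != 0, r <= pabs g &
    exists z : laurent F, psi (pabs g) = labs z].

Lemma labs_ge0 x : 0 <= labs x :> R.
Proof. by rewrite /labs; case: ifP => // _; exact: expR_ge0. Qed.

Lemma ldeg_top x : x != 0 -> x (ldeg x) != 0 /\ ldeg_le x (ldeg x).
Proof. by move=> /laurent_top[N xN bN]; rewrite (ldegE xN bN). Qed.

Lemma labs_ultra x y : labs (x - y) <= Num.max (labs x) (labs y) :> R.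
Proof.
have [->|d0] := eqVneq (x - y) 0; first by rewrite labs0 le_max labs_ge0.
have le (z : laurent F) : z (ldeg (x - y)) != 0 -> labs (x - y) <= labs z :> R.
  move=> zd; have z0 : z != 0 by apply: contraNneq zd => ->.
  rewrite /labs (negbTE d0) (negbTE z0) ler_expR ler_int leNgt.
  have [_ bz] := ldeg_top z0.
  by apply/negP => /bz ze; rewrite ze eqxx in zd.
have [+ _] := ldeg_top d0; rewrite lcoefB le_max => dn0.
have [x0|x0] := eqVneq (x (ldeg (x - y))) 0; last by rewrite le.
by rewrite (le y) ?orbT // -oppr_eq0 -[- _]add0r -[X in X - _]x0.
Qed.

Lemma lnorm_labs n (v : 'rV[laurent F]_n) :
  exists z : laurent F, lnorm v = labs z :> R.
Proof.
rewrite /lnorm; elim/big_ind: _ => [|a b [z ->] [w ->]|i _].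
- by exists 0; rewrite labs0.
- by case: (leP (labs z) (labs w)) => _; [exists w|exists z].
- by exists (v 0 i).
Qed.

Lemma labs_le_lnorm n (v : 'rV[laurent F]_n) i : labs (v 0 i) <= lnorm v :> R.
Proof. exact: le_bigmax. Qed.

Lemma size_le_pabs g : g != 0 -> (size g)%:R <= pabs g :> R.
Proof.
move=> g0; rewrite /pabs labs_poly // -(prednK (n := size g)) ?size_poly_gt0 //=.
by rewrite -natr1 addrC expR_ge1Dx.
Qed.

Lemma pabs_ge1 g : g != 0 -> 1 <= pabs g :> R.
Proof. by move=> g0; rewrite /pabs labs_poly // -expR0 ler_expR. Qed.

End AbsoluteValue.

Arguments labs {R F}.
Arguments pabs {R F}.
Arguments lnorm {R F n}.
Arguments pabs_oo R F : clear implicits.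
Arguments Exact {R} F n psi.
Arguments lambda_ {R} F psi.
Arguments attains_values {R} F psi.

Lemma Exact_attains_value (R : realType) (F : finFieldType) n (psi : R -> R) :
  (forall r s : R, 0 < r -> r <= s -> psi s <= psi r) ->
  Exact F n psi !=set0 -> attains_values F psi.
Proof.
move=> psi_ni [x [x1 xinf _]] r; apply: contrapT => nex; apply: xinf.
pose C := Num.max 1 (psi 1).
pose B := (Num.truncn (Num.max 1 (C * r))).+1.
have hB (f : {poly F}) : pabs f <= Num.max 1 (C * r) -> (size f <= B)%N.
  move=> le; have [->|f0] := eqVneq f 0; first by rewrite size_poly0.
  rewrite -(ler_nat R); apply: (le_trans (size_le_pabs _ f0)); apply: (le_trans le).
  by rewrite ltW // truncnS_gt.
have C1 : 1 <= C by rewrite le_max lexx.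
pose h (t : {ffun 'I_B -> F}) : {poly F} :=
  \poly_(k < B) (if insub k is Some k' then t k' else 0).
have hP (f : {poly F}) : (size f <= B)%N -> f = h [ffun k : 'I_B => f`_k].
  move=> sf; apply/polyP => k; rewrite coef_poly; case: ltnP => kB.
    by case: insubP => [k' _ <-|]; rewrite ?ffunE ?kB.
  by rewrite nth_default // (leq_trans sf).
pose H (t : {ffun 'I_n -> {ffun 'I_B -> F}} * {ffun 'I_B -> F}) :
  'rV[{poly F}]_n * {poly F} := (\row_i h (t.1 i), h t.2).
apply: (@sub_finite_set _ _ (range H)); last by apply: finite_image; exact: finite_finset.
move=> [f g] /= [g0 e].
have gr : pabs g < r.
  rewrite ltNge; apply/negP => rg; apply: nex; exists g; split => //.
  by have [z ez] := lnorm_labs R (x - ratvec f g); exists z; rewrite -e.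
have g1 := pabs_ge1 R g0.
have sg : (size g <= B)%N.
  apply: hB; rewrite le_max; apply/orP; right; apply: (le_trans (ltW gr)).
  by rewrite ler_peMl // ltW // (le_lt_trans _ gr) // (le_trans ler01).
exists ([ffun i => [ffun k : 'I_B => (f 0 i)`_k]], [ffun k : 'I_B => g`_k]) => //.
rewrite /H /= -hP //; congr pair; apply/rowP => i; rewrite mxE ffunE -hP //.
apply: hB; rewrite le_max; apply/orP; right.
have gn0 : poly_laurent g != 0.
  by apply/eqP => ge; move: g1; rewrite /pabs ge labs0 ler10.
have -> : pabs (f 0 i) = labs (poly_laurent (f 0 i) / poly_laurent g) * pabs g :> R.
  by rewrite /pabs -labsM divfK.
apply: ler_pM; rewrite ?labs_ge0 //; last exact: ltW.
have -> : poly_laurent (f 0 i) / poly_laurent g = x 0 i - (x - ratvec f g) 0 i.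
  by rewrite !mxE subKr.
apply: (le_trans (labs_ultra _ _ _)); rewrite ge_max (le_trans (x1 i)) //=.
apply: (le_trans (labs_le_lnorm _ _ _)); rewrite e le_max psi_ni ?orbT //.
Qed.

(* Main.v *)
Require Import Defs.
From mathcomp Require Import all_boot all_order all_algebra.
From mathcomp Require Import zify ring.
From mathcomp Require Import all_classical all_reals all_analysis.

Set Implicit Arguments.
Unset Strict Implicit.

Import Order.TTheory GRing.Theory Num.Theory.
Import numFieldNormedType.Exports.

Local Open Scope classical_set_scope.
Local Open Scope ring_scope.

(* The point x is the limit of a multidimensional continued fraction. Keep a  *)
(* basis v, w_1, ..., w_n of F[X]^(n+1), seen as rational points, such that   *)
(* the vectors g_(w_i) f_v / g_v - f_(w_i) of K^n have norms e^(-m_i) and are *)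
(* orthogonal for the ultrametric norm; then deg g_v = m_1 + ... + m_n. One   *)
(* step takes the index i with m_i minimal, replaces v by X^e v + w_i and w_i *)
(* by the old v, and adds e to m_i. It moves the point by exactly             *)
(* e^-(deg g_v + e + m_i). Steps with e = 1 equalise the m_i, which makes all *)
(* rationals f/g of comparable height stay at distance at least of order      *)
(* |g|^-((n+1)/n), much more than psi(|g|). Whenever the m_i are balanced and *)
(* psi(|g_v|) is a power e^-z, a single large step with e = z - deg g_v - m_i *)
(* puts x at distance exactly psi(|g_v|) from v.                              *)

(** The point x must satisfy two competing demands: distance exactly psi(|g|) for infinitely many
    f/g, and never less once |g| is large. The construction above splits the rationals V = f/g into
    two kinds ([traj_exact]). If V is a multiple of a jump vector v, then ||x - V|| = psi(|g_v|),
    and psi(|g|) <= psi(|g_v|) because psi is non-increasing. Otherwise ||x - V|| is at least a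
    constant times |g|^(-(n+1)/n), which psi(|g|) = o(...) undercuts. The distance to a jump vector
    survives in the limit because all later moves are strictly shorter ([traj_limit]). Jumps recur
    forever because unit steps restore balance and then run through every degree ([jump_later]),
    while psi takes values in the value group at unboundedly large degrees. The lower bound
    ([traj_lower]) expands V in the current basis: orthogonality prevents cancellation
    ([size_cross_comb], [size_cross_ge]), and at most one exponent is out of balance, namely one
    whose companion is a jump vector ([traj_balance]). *)

Section Norms.
Context {R : realType} {F : fieldType}.
Implicit Types (x y : laurent F) (N : int).

(** * Ultrametric norms and completeness *)

Lemma labs_le_expR x N : labs x <= expR N%:~R :> R <-> ldeg_le x N.
Proof.
rewrite /labs; case: eqVneq => [->|x0]; first by rewrite expR_ge0.
have [xd xb] := ldeg_top x0; rewrite ler_expR ler_int; split.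
  by move=> le i /(le_lt_trans le); exact: xb.
by move=> xN; rewrite leNgt; apply: contra_neqN xd => /xN.
Qed.

Lemma lnorm_le n (v : 'rV[laurent F]_n) (r : R) :
  0 <= r -> (forall j, labs (v 0 j) <= r) -> lnorm v <= r.
Proof. by move=> r0 vr; apply: bigmax_le. Qed.

Lemma lnorm_ultra n (v w : 'rV[laurent F]_n) :
  lnorm (v - w) <= Num.max (lnorm v) (lnorm w) :> R.
Proof.
apply: lnorm_le => [|j].
  by rewrite le_max /lnorm bigmax_ge_id.
rewrite !mxE; apply: (le_trans (labs_ultra _ _ _)).
by rewrite ge_max !le_max !labs_le_lnorm orbT.
Qed.

Lemma lnormN n (v : 'rV[laurent F]_n) : lnorm (- v) = lnorm v :> R.
Proof.
have z : lnorm (0 : 'rV[laurent F]_n) = 0 :> R.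
  by apply/eqP; rewrite eq_le lnorm_le //= /lnorm ?bigmax_ge_id // => j; rewrite mxE labs0.
have le (w : 'rV[laurent F]_n) : lnorm (- w) <= lnorm w :> R.
  rewrite -[- w]sub0r; have /le_trans := lnorm_ultra 0 w; apply.
  by rewrite z ge_max lexx andbT /lnorm bigmax_ge_id.
by apply/eqP; rewrite eq_le le -{1}[v]opprK le.
Qed.

Lemma lnormBC n (v w : 'rV[laurent F]_n) : lnorm (v - w) = lnorm (w - v) :> R.
Proof. by rewrite -lnormN opprB. Qed.

(** Isosceles triangle principle; it carries lower bounds from a convergent y over to the limit
    x. *)
Lemma lnorm_far n (x y z : 'rV[laurent F]_n) :
  lnorm (x - y) < lnorm (z - y) :> R -> lnorm (z - y) <= lnorm (x - z) :> R.
Proof.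
move=> lt; have := lnorm_ultra (x - y) (x - z).
have -> : x - y - (x - z) = z - y by rewrite opprB addrC addrA subrK.
by rewrite le_max leNgt lt.
Qed.

(** Completeness with an explicit rate: the coefficient of index i stops changing once [eps k]
    exceeds -i. *)
Lemma laurent_limit (y : nat -> laurent F) (eps : nat -> nat) :
  (forall k, (k <= eps k)%N) -> (forall k, (eps k <= eps k.+1)%N) ->
  (forall k, ldeg_le (y k.+1 - y k) (- (eps k)%:Z)) ->
  exists x, forall k, ldeg_le (x - y k) (- (eps k)%:Z).
Proof.
move=> epsk epsS yS.
have stab (k l : nat) (i : int) : (k <= l)%N -> - (eps k)%:Z < i -> y l i = y k i.
  move=> /subnK <- ei; elim: (l - k)%N => // t <-; apply/eqP.
  rewrite -subr_eq0 -lcoefB addSn yS //.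
  suff : (eps k <= eps (t + k))%N by lia.
  by elim: t => // t IH; rewrite addSn (leq_trans IH).
(* As [eps k] is at least k, coefficient i is final from step |i| + 1 on. *)
have b : exists N, forall i, N < i -> (fun i : int => y `|i|.+1 i) i = 0.
  have [N yN] := lcoef_bounded (y 0%N); exists (Num.max N 0) => i.
  rewrite gt_max => /andP[Ni i0]; rewrite (stab 0%N) ?yN //; lia.
exists (Laurent b) => k i ik; rewrite lcoefB /=; apply/eqP; rewrite subr_eq0.
have ek := epsk `|i|.+1; case: (leqP k `|i|.+1) => kl; first by rewrite (stab k).
by rewrite -(stab `|i|.+1 k) // 1?ltnW //; lia.
Qed.

Lemma lnorm_limit n (y : nat -> 'rV[laurent F]_n) (eps : nat -> nat) :
  (forall k, (k <= eps k)%N) -> (forall k, (eps k <= eps k.+1)%N) ->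
  (forall k, lnorm (y k.+1 - y k) <= expR (- (eps k)%:R) :> R) ->
  exists x : 'rV[laurent F]_n, forall k, lnorm (x - y k) <= expR (- (eps k)%:R) :> R.
Proof.
move=> epsk epsS yS.
have E k : - (eps k)%:R = (- (eps k)%:Z)%:~R :> R by rewrite mulrNz.
have H (j : 'I_n) : exists x, forall k, ldeg_le (x - y k 0 j) (- (eps k)%:Z).
  apply: laurent_limit => // k; apply/labs_le_expR; rewrite -E.
  by apply: le_trans (yS k); have := @labs_le_lnorm R _ _ (y k.+1 - y k) j; rewrite !mxE.
have [x xP] := choice H; exists (\row_j x j) => k.
apply: lnorm_le => [|j]; first exact: expR_ge0.
by rewrite !mxE E; apply/labs_le_expR.
Qed.

End Norms.

(* [lia] alone fails to identify sizes of polynomials whose coefficient       *)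
(* structures are convertible but not syntactically equal.                    *)
Ltac size_lia := repeat (move: (size _) => ?); lia.

(** * Bases of F[X]^(n+1) and their continued fraction steps *)

Section States.
Context {F : fieldType} {n : nat}.

(* [None] indexes the denominator and [Some j] the j-th numerator. *)
Definition ivec := option 'I_n -> {poly F}.
Implicit Types (v w V : ivec) (i j u : 'I_n).

(** A 2x2 minor. Divided by [v None] it is a coordinate of the vector in the header; divided by both
    denominators it is a coordinate of the difference of the two rational points ([labs_cross]). *)
Definition cross v V j := V None * v (Some j) - V (Some j) * v None.

Lemma cross_plucker v v' V j :
  v None * cross v' V j = v' None * cross v V j - V None * cross v v' j.
Proof. by rewrite /cross; ring. Qed.

(* The v, w_i and m_i of the header. *)
Record state := State {
  vec : ivec;
  com : 'I_n -> ivec;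
  expo : 'I_n -> nat }.
Implicit Types s : state.

Definition deg s := (\sum_i expo s i)%N.

(** Orthogonality is encoded as diagonal dominance: row i of the minors has degree deg s - m_i at
    coordinate i and smaller degree elsewhere. Sizes and additions cover the zero polynomial and
    avoid truncated subtraction. *)
Record good s : Prop := Good {
  size_vec : size (vec s None) = (deg s).+1;
  size_com : forall i j, (size (com s i None) + expo s i <= (deg s + expo s j).+1)%N;
  size_cross_diag :
    forall i, (size (cross (vec s) (com s i) i) + expo s i = (deg s).+1)%N;
  size_cross_offdiag : forall i j, j != i ->
    (size (cross (vec s) (com s i) j) + expo s i <= deg s)%N;
  state_span : forall V, exists (c : {poly F}) (b : 'I_n -> {poly F}),
    forall o, V o = c * vec s o + \sum_i b i * com s i o }.

Lemma expo_le_deg s i : (expo s i <= deg s)%N.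
Proof. by rewrite /deg (bigD1 i) //= leq_addr. Qed.

Definition init_state : state := {|
  vec := fun o => (o == None)%:R;
  com := fun i o => - (o == Some i)%:R;
  expo := fun=> 0%N |}.

Lemma deg_init : deg init_state = 0%N.
Proof. by rewrite /deg big1. Qed.

Lemma good_init : good init_state.
Proof.
split; rewrite ?deg_init /cross //=.
- by rewrite size_poly1.
- by move=> i j; rewrite oppr0 size_poly0.
- by move=> i; rewrite mulr1 !oppr0 mul0r sub0r opprK eqxx size_poly1.
- move=> i j ji; rewrite mulr1 !oppr0 mul0r sub0r opprK (_ : _ == _ = false) ?size_poly0 //.
  by apply/eqP => -[/eqP]; rewrite (negbTE ji).
move=> V; exists (V None), (fun i => - V (Some i)) => -[j|] /=; last first.
  by rewrite mulr1 big1 ?addr0 // => i _; rewrite oppr0 mulr0.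
rewrite mulr0 add0r (bigD1 j) //= eqxx mulrNN mulr1 big1 ?addr0 // => i ij.
rewrite (_ : _ == _ = false) ?oppr0 ?mulr0 //.
by apply/eqP => -[/eqP]; rewrite eq_sym (negbTE ij).
Qed.

Definition step (i : 'I_n) (e : nat) s : state := {|
  vec := fun o => 'X^e * vec s o + com s i o;
  com := fun k => if k == i then vec s else com s k;
  expo := fun k => if k == i then (expo s i + e)%N else expo s k |}.

Lemma deg_step i e s : deg (step i e s) = (deg s + e)%N.
Proof.
rewrite /deg (bigD1 i) //= eqxx [in RHS](bigD1 i) //= addnAC; congr (_ + _ + _)%N.
by apply: eq_bigr => k /negbTE ->.
Qed.

Lemma cross_step i e s j :
  cross (vec s) (vec (step i e s)) j = cross (vec s) (com s i) j.
Proof. by rewrite /cross /=; ring. Qed.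

Lemma good_vec_neq0 s : good s -> vec s None != 0.
Proof. by move=> gs; rewrite -size_poly_gt0 size_vec. Qed.

(** Minors with the new vector are read off from [cross_plucker] after multiplication by
    [vec s None]. Minimality of m_i bounds the degree of the new companion, which is the old
    vector. *)
Lemma good_step i e s : (0 < e)%N -> (forall j, expo s i <= expo s j)%N ->
  good s -> good (step i e s).
Proof.
move=> e0 imin gs; have [sv sc sd so sp] := gs.
have v0 := good_vec_neq0 gs.
have sv' : size (vec (step i e s) None) = (deg s + e).+1.
  rewrite /= size_polyDl mulrC size_mulXn // sv ?addnS ?addSn ?(addnC e) //.
  by have := sc i i; size_lia.
have v'0 : vec (step i e s) None != 0 by rewrite -size_poly_gt0 sv'.
have step_le j k : (size (vec s None * cross (vec (step i e s)) (com s k) j)%R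
   <= maxn (deg s + e + size (cross (vec s) (com s k) j))
           (size (com s k None) + (deg s - expo s i)))%N.
  rewrite cross_plucker cross_step; apply: (leq_trans (size_polyD _ _)).
  rewrite size_polyN geq_max !leq_max; apply/andP; split; apply/orP; [left|right].
    by apply: (leq_trans (size_polyMleq _ _)); rewrite sv' /=.
  apply: (leq_trans (size_polyMleq _ _)).
  have := expo_le_deg s i; have := sd i; have := @so i j.
  by case: (eqVneq j i) => [->|_ /(_ isT)]; size_lia.
have mulv p : p != 0 -> size (vec s None * p) = (deg s + size p)%N.
  by move=> p0; rewrite (size_mul v0 p0) sv.
split.
- by rewrite deg_step.
- move=> k j; rewrite deg_step /=; case: (eqVneq k i) => [_|ki].
    by rewrite sv; case: ifP => _; have := imin j; size_lia.
  by case: ifP => [/eqP jE|_]; [subst j; have := sc k i|have := sc k j]; rewrite /=; size_lia.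
- move=> k; rewrite deg_step /=; case: (eqVneq k i) => [->|ki].
    have -> : cross (fun o => 'X^e * vec s o + com s i o) (vec s) i =
       - cross (vec s) (com s i) i by rewrite /cross; ring.
    by rewrite size_polyN addnA sd.
  have cne : cross (vec s) (com s k) k != 0.
    by rewrite -size_poly_gt0; have := sd k; have := expo_le_deg s k; size_lia.
  (* In the Plücker relation the first term dominates strictly: [size_com] at (k, i) and the
     off-diagonal bound for row i contribute m_i with opposite signs, leaving a degree below the
     first term. *)
  have hs : size (vec s None * cross (vec (step i e s)) (com s k) k) =
    (deg s + e + size (cross (vec s) (com s k) k))%N.
    rewrite cross_plucker cross_step size_polyDl.
      by rewrite (size_mul v'0 cne) sv'.
    rewrite size_polyN (size_mul v'0 cne) sv' /=.
    apply: (leq_ltn_trans (size_polyMleq _ _)).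
    have := sc k i; have := sd k; have := @so i k ki.
    by have := expo_le_deg s k; have := expo_le_deg s i; size_lia.
  move: hs; have [->|?] := eqVneq (cross (vec (step i e s)) (com s k) k) 0.
    by rewrite mulr0 size_poly0; have := sd k; have := expo_le_deg s k; size_lia.
  by rewrite mulv //; have := sd k; rewrite /=; size_lia.
- move=> k j jk; rewrite deg_step /=; case: (eqVneq k i) => [ki|ki].
    have -> : cross (fun o => 'X^e * vec s o + com s i o) (vec s) j =
       - cross (vec s) (com s i) j by rewrite /cross; ring.
    by rewrite size_polyN addnA leq_add2r so // -ki.
  have := step_le j k; have [->|?] := eqVneq (cross (vec (step i e s)) (com s k) j) 0.
    by rewrite size_poly0 => _; have := expo_le_deg s k; size_lia.
  rewrite mulv // leq_max; have := sc k i; have := so k j jk.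
  by have := expo_le_deg s k; have := expo_le_deg s i; rewrite /=; size_lia.
move=> V; have [c [b Vcb]] := sp V.
(* This is c v + b_i w_i = b_i (X^e v + w_i) + (c - X^e b_i) v. *)
exists (b i), (fun k => if k == i then c - 'X^e * b i else b k) => o.
rewrite Vcb (bigD1 i) //= [in RHS](bigD1 i) //= eqxx.
rewrite (eq_bigr (fun k => (if k == i then c - 'X^e * b i else b k) *
   (if k == i then vec s else com s k) o)) /=; last by move=> k /negbTE ->.
by ring.
Qed.

Lemma cross_comb (v V : ivec) (w : 'I_n -> ivec) c b j :
  (forall o, V o = c * v o + \sum_i b i * w i o) ->
  cross v V j = \sum_i b i * cross v (w i) j.
Proof.
move=> VE; rewrite /cross !VE !mulrDl opprD addrACA -!mulrA.
rewrite [v None * _]mulrC subrr add0r !mulr_suml -sumrB.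
by apply: eq_bigr => i _; ring.
Qed.

(* The rows [cross v (w i)] have their strict maximum on the diagonal, so no  *)
(* cancellation occurs in the coordinate where [b i] times row [i] is largest. *)
Lemma size_cross_comb s V c b i : good s ->
  (forall o, V o = c * vec s o + \sum_i b i * com s i o) -> b i != 0 ->
  exists j, (size (b i) + deg s <= size (cross (vec s) V j) + expo s i)%N.
Proof.
move=> gs VE bi0; have [sv sc sd so sp] := gs.
pose P := [pred k | b k != 0].
case: (@arg_maxnP _ i P (fun k => size (b k) + (deg s - expo s k))%N bi0).
move=> k bk0 kmax; exists k; rewrite (cross_comb _ VE) (bigD1 k) //=.
have cne : cross (vec s) (com s k) k != 0.
  by rewrite -size_poly_gt0; have := sd k; have := expo_le_deg s k; size_lia.
have bk : size (b k * cross (vec s) (com s k) k) = (size (b k) + (deg s - expo s k))%N.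
  by rewrite (size_mul bk0 cne); have := sd k; have := expo_le_deg s k; size_lia.
rewrite size_polyDl bk.
  by have := kmax i bi0; have := expo_le_deg s i; rewrite /=; size_lia.
have gt0 : (0 < size (b k) + (deg s - expo s k))%N 
  by rewrite addn_gt0 size_poly_gt0 (bk0 : b k != 0).
rewrite -(prednK gt0) ltnS; apply: (leq_trans (size_sum _ _ _)).
apply/bigmax_leqP => l lk; have [->|bl0] := eqVneq (b l) 0.
  by rewrite mul0r size_poly0.
apply: (leq_trans (size_polyMleq _ _)).
have kl : k != l by rewrite eq_sym.
have := kmax l bl0; have := so l k kl; have := expo_le_deg s l; rewrite /=.
have : (0 < size (b l))%N by rewrite size_poly_gt0.
size_lia.
Qed.

(* As [V None] has degree less than [deg s], the leading term of c * vec s    *)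
(* cancels, which forces a companion coefficient of large degree.             *)
Lemma size_cross_ge s V c b u : good s ->
  (forall o, V o = c * vec s o + \sum_i b i * com s i o) -> c != 0 ->
  (size (V None) <= deg s)%N ->
  exists j, (deg s < size (cross (vec s) V j) + expo s u)%N.
Proof.
move=> gs VE c0 sV; have [sv sc sd so sp] := gs.
have v0 := good_vec_neq0 gs.
have /existsP[i bi] : [exists i, (deg s < size (b i * com s i None)%R)%N].
  apply: contraT; rewrite negb_exists => /forallP small.
  have : (deg s < size (V None))%N.
    rewrite VE size_polyDl (size_mul c0 v0) sv ?addnS /= ?leq_addl //.
      by have : (0 < size c)%N by [rewrite size_poly_gt0]; size_lia.
    apply: (@leq_ltn_trans (deg s)); last first.
      by have : (0 < size c)%N by [rewrite size_poly_gt0]; size_lia.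
    apply: (leq_trans (size_sum _ _ _)); apply/bigmax_leqP => i _.
    by rewrite leqNgt.
  by rewrite ltnNge sV.
have bi0 : b i != 0 by apply: contraTneq bi => ->; rewrite mul0r size_poly0.
have [j bj] := size_cross_comb gs VE bi0; exists j.
have := leq_trans bi (size_polyMleq _ _); have := sc i u.
have : (0 < size (b i))%N by rewrite size_poly_gt0.
by move: bj; size_lia.
Qed.

End States.

(** * Distances between rational points as degrees of minors *)

Section Rationals.
Context {R : realType} {F : fieldType} {n : nat}.
Implicit Types v V : @ivec F n.

Definition ratpoint V : 'rV[laurent F]_n :=
  \row_j (poly_laurent (V (Some j)) / poly_laurent (V None)).

Lemma poly_laurent_eq0 (p : {poly F}) : (poly_laurent p == 0) = (p == 0).
Proof.
apply/eqP/eqP => [e|->]; last by rewrite rmorph0.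
apply/polyP => k; rewrite coef0.
exact: (congr1 (fun x : laurent F => x k%:Z) e).
Qed.

Lemma ratpoint_scale (c : {poly F}) v V : V None != 0 ->
  (forall o, V o = c * v o) -> ratpoint V = ratpoint v.
Proof.
move=> V0 Vc; apply/rowP => j; rewrite !mxE !Vc !rmorphM /= invfM mulrACA.
rewrite divff ?mul1r // poly_laurent_eq0.
by apply: contraNneq V0 => c0; rewrite Vc c0 mul0r.
Qed.

Lemma labs_cross v V j : v None != 0 -> V None != 0 ->
  labs ((ratpoint v - ratpoint V) 0 j) =
  labs (poly_laurent (cross v V j)) *
    expR (- ((size (v None)).-1 + (size (V None)).-1)%:R) :> R.
Proof.
move=> v0 V0; rewrite !mxE natrD expRN expRD -!labs_poly // -labsM.
have vV0 : poly_laurent (v None) * poly_laurent (V None) != 0.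
  by rewrite mulf_neq0 ?poly_laurent_eq0.
have lv0 : labs (poly_laurent (v None) * poly_laurent (V None)) != 0 :> R.
  by rewrite /labs (negbTE vV0) gt_eqF ?expR_gt0.
apply: (mulIf lv0); rewrite mulfVK // -labsM; congr labs.
move: vV0; rewrite mulf_eq0 negb_or => /andP[a b].
rewrite /cross rmorphB !rmorphM /=.
by field; apply/andP.
Qed.

Lemma lnorm_cross_ge v V j (d d' N : nat) : size (v None) = d.+1 ->
  size (V None) = d'.+1 -> (d + d' < size (cross v V j) + N)%N ->
  cross v V j != 0 ->
  expR (- N%:R) <= lnorm (ratpoint v - ratpoint V) :> R.
Proof.
move=> sv sV le c0; apply: le_trans (labs_le_lnorm _ _ j).
rewrite labs_cross -?size_poly_gt0 ?sv ?sV // labs_poly // -expRD ler_expR.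
rewrite lerBrDr [- _ + _]addrC lerBlDr -natrD ler_nat.
have : (0 < size (cross v V j))%N by rewrite size_poly_gt0.
by move: le; size_lia.
Qed.

Lemma lnorm_cross_le v V (d d' N : nat) : size (v None) = d.+1 ->
  size (V None) = d'.+1 -> (forall j, (size (cross v V j) + N <= (d + d').+1)%N) ->
  lnorm (ratpoint v - ratpoint V) <= expR (- N%:R) :> R.
Proof.
move=> sv sV le; apply: lnorm_le => [|j]; first exact: expR_ge0.
rewrite labs_cross -?size_poly_gt0 ?sv ?sV //=.
have [->|c0] := eqVneq (cross v V j) 0.
  by rewrite rmorph0 labs0 mul0r expR_ge0.
rewrite labs_poly // -expRD ler_expR lerBlDr [- _ + _]addrC lerBrDr -!natrD ler_nat.
have : (0 < size (cross v V j))%N by rewrite size_poly_gt0.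
by move: (le j); size_lia.
Qed.

End Rationals.

(** * The sequence of bases, its limit, and the distances from the limit to all rationals *)

Section Trajectory.
Context {R : realType} {F : fieldType} {n : nat}.
(** In the application D holds the large degrees d with psi(e^d) = e^-z(d). The bound [z_large]
    makes the length of every jump positive. *)
Variables (i0 : 'I_n) (D : pred nat) (z : nat -> nat).
Hypothesis D_unbounded : forall N, exists2 d, (N <= d)%N & D d.
Hypothesis z_large : forall d M, D d -> (n * M <= d)%N -> (d + M < z d)%N.
Implicit Types (s : @state F n) (V : @ivec F n).

Definition argmin s := [arg min_(i < i0) expo s i].
Definition minexpo s := expo s (argmin s).
Definition balanced s := [forall i, forall j, expo s i <= (expo s j).+1]%N.
Definition jump s := balanced s && D (deg s).

(* A jump makes the distance between two consecutive points exactly e^-z(d). *)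
Definition step_size s := if jump s then (z (deg s) - deg s - minexpo s)%N else 1%N.

Fixpoint traj (k : nat) : @state F n :=
  if k is l.+1 then step (argmin (traj l)) (step_size (traj l)) (traj l)
  else init_state.

Lemma minexpoP s i : (minexpo s <= expo s i)%N.
Proof. by rewrite /minexpo /argmin; case: arg_minnP => // k _; apply. Qed.

(** The source of the exponent (n+1)/n: the least of n numbers with sum deg s is at most deg s /
    n. *)
Lemma minexpo_deg s : (n * minexpo s <= deg s)%N.
Proof.
rewrite /deg -[n in (n * _)%N]card_ord -sum_nat_const.
by apply: leq_sum => i _; exact: minexpoP.
Qed.

Lemma jump_size s : jump s -> (deg s + minexpo s < z (deg s))%N.
Proof. by move=> /andP[_ Ds]; apply: z_large (minexpo_deg s). Qed.

Lemma step_size_gt0 s : (0 < step_size s)%N.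
Proof. by rewrite /step_size; case: ifP => // /jump_size; lia. Qed.

Lemma good_traj k : good (traj k).
Proof.
elim: k => [|k IH]; first exact: good_init.
apply: good_step => //; [exact: step_size_gt0|exact: minexpoP].
Qed.

Lemma deg_trajS k : deg (traj k.+1) = (deg (traj k) + step_size (traj k))%N.
Proof. exact: deg_step. Qed.

Lemma leq_deg_traj k : (k <= deg (traj k))%N.
Proof.
elim: k => // k IH; rewrite deg_trajS.
by have := step_size_gt0 (traj k); lia.
Qed.

Lemma expo_trajS k i : (expo (traj k) i <= expo (traj k.+1) i)%N.
Proof. by rewrite /=; case: eqP => // ->; rewrite leq_addr. Qed.

Lemma minexpo_trajS k : (minexpo (traj k) <= minexpo (traj k.+1))%N.
Proof. exact: leq_trans (minexpoP _ _) (expo_trajS _ _). Qed.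

Definition eps k := (deg (traj k.+1) + minexpo (traj k))%N.

Lemma eps_lt k : (eps k < eps k.+1)%N.
Proof.
rewrite /eps [deg (traj k.+2)]deg_trajS; have := minexpo_trajS k.
by have := step_size_gt0 (traj k.+1); lia.
Qed.

Lemma eps_jump k : jump (traj k) -> eps k = z (deg (traj k)).
Proof.
move=> jk; rewrite /eps deg_trajS /step_size jk.
by have := jump_size jk; lia.
Qed.

Definition point k := ratpoint (vec (traj k)).

Lemma lnorm_pointS k :
  lnorm (point k.+1 - point k) = expR (- (eps k)%:R) :> R.
Proof.
have gk := good_traj k; have sv := size_vec gk; have sv' := size_vec (good_traj k.+1).
have sd := size_cross_diag gk (argmin (traj k)).
rewrite lnormBC; apply/eqP; rewrite eq_le; apply/andP; split.
  apply: (lnorm_cross_le sv sv') => j; rewrite cross_step.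
  have := @size_cross_offdiag _ _ _ gk (argmin (traj k)) j.
  move: sd; case: (eqVneq j (argmin (traj k))) => [->|_ sd /(_ isT)];
    by rewrite /eps /minexpo; size_lia.
apply: (@lnorm_cross_ge _ _ _ _ _ (argmin (traj k)) _ _ _ sv sv').
  by rewrite cross_step; move: sd; rewrite /eps /minexpo; size_lia.
rewrite cross_step -size_poly_gt0; have := expo_le_deg (traj k) (argmin (traj k)).
by move: sd; size_lia.
Qed.

(** Since [eps] increases strictly, everything after move k is shorter than move k, so the limit is
    as far from [point k] as [point k.+1] is. *)
Lemma traj_limit :
  exists x, forall k, lnorm (x - point k) = expR (- (eps k)%:R) :> R.
Proof.
have [||k|x xP] := @lnorm_limit R F n point eps.
- by move=> k; apply: leq_trans (leq_addr _ _); rewrite ltnW // leq_deg_traj.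
- by move=> k; exact/ltnW/eps_lt.
- by rewrite lnorm_pointS.
exists x => k; apply/eqP; rewrite eq_le xP /= -lnorm_pointS.
have lt : lnorm (x - point k.+1) < lnorm (point k - point k.+1) :> R.
  rewrite [ltRHS]lnormBC lnorm_pointS; apply: le_lt_trans (xP _) _.
  by rewrite ltr_expR ltrN2 ltr_nat eps_lt.
by rewrite [leLHS]lnormBC; exact: lnorm_far.
Qed.

(** A jump starts from balanced exponents and inflates only that of the treated index u, whose
    companion becomes the jump vector. A unit step raises only the minimum, so it destroys no
    balance, and it either keeps that companion or treats u itself, which is then minimal. *)
Lemma traj_balance k : exists u,
  (forall i j, i != u -> (expo (traj k) i <= (expo (traj k) j).+1)%N) /\
  ((forall j, (expo (traj k) u <= (expo (traj k) j).+1)%N) \/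
   exists2 l, jump (traj l) & com (traj k) u = vec (traj l)).
Proof.
elim: k => [|k [u [bal hu]]]; first by exists i0; split=> //; left.
have minP := minexpoP (traj k); have eS := expo_trajS k.
have [jk|jk] := boolP (jump (traj k)).
  exists (argmin (traj k)); split; last first.
    by right; exists k => //=; rewrite eqxx.
  move=> i j /negbTE ik; apply: (@leq_trans (expo (traj k) j).+1); last exact: eS.
  by move/andP: jk => [/forallP/(_ i)/forallP/(_ j) + _]; rewrite /= ik.
have e1 : step_size (traj k) = 1%N by rewrite /step_size (negbTE jk).
have inc i : (forall j, (expo (traj k) i <= (expo (traj k) j).+1)%N) ->
    forall j, (expo (traj k.+1) i <= (expo (traj k.+1) j).+1)%N.
  move=> bi j; apply: (@leq_trans (expo (traj k) j).+1); last exact: eS.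
  rewrite /= e1; case: eqP => [_|_]; last exact: bi.
  by rewrite addn1 ltnS; exact: minP.
exists u; split; first by move=> i j iu; apply: inc => j'; exact: bal.
have [uE|uN] := eqVneq u (argmin (traj k)).
  by left; apply: inc => j; rewrite uE; apply: leqW; exact: minP.
case: hu => [hu|[l jl cl]]; first by left; exact: inc.
by right; exists l => //=; rewrite (negbTE uN).
Qed.

(** While the exponents are unbalanced, a unit step raises the minimum to below the maximum, so all
    exponents stay bounded; but the degree grows without bound. *)
Lemma balanced_later k : (forall l, (k <= l)%N -> ~~ jump (traj l)) ->
  exists2 l, (k <= l)%N & balanced (traj l).
Proof.
move=> nj; pose B := deg (traj k).
have e1 l : step_size (traj (k + l)) = 1%N.
  by rewrite /step_size (negbTE (nj _ _)) // leq_addr.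
have [[l /andP[kl bl]]|nb] := pselect (exists l, (k <= l)%N && balanced (traj l)).
  by exists l.
have le l : forall i, (expo (traj (k + l)) i <= B)%N.
  elim: l => [|l IH] i; first by rewrite addn0; exact: expo_le_deg.
  rewrite addnS /= e1; case: eqP => [_|_]; last exact: IH.
  have /negP : ~ balanced (traj (k + l)).
    by move=> bl; apply: nb; exists (k + l)%N; rewrite leq_addr.
  rewrite negb_forall => /existsP[a]; rewrite negb_forall => /existsP[b].
  by have := minexpoP (traj (k + l)) b; have := IH a; rewrite /minexpo; lia.
have := leq_deg_traj (k + (n * B).+1)%N.
have : (deg (traj (k + (n * B).+1)) <= n * B)%N.
  rewrite /deg -[n in (n * B)%N]card_ord -sum_nat_const.
  by apply: leq_sum => i _; exact: le.
by lia.
Qed.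

(** Without jumps, balance is reached and kept while the degree grows by one at a time, so it
    eventually meets D. *)
Lemma jump_later k : exists2 l, (k <= l)%N & jump (traj l).
Proof.
apply: contrapT => nj'.
have nj l : (k <= l)%N -> ~~ jump (traj l).
  by move=> kl; apply/negP => jl; apply: nj'; exists l.
have [l kl bl] := balanced_later nj.
have bt t : balanced (traj (l + t)) /\ deg (traj (l + t)) = (deg (traj l) + t)%N.
  elim: t => [|t [IH1 IH2]]; first by rewrite !addn0.
  have e1 : step_size (traj (l + t)) = 1%N.
    by rewrite /step_size (negbTE (nj _ _)) // (leq_trans kl) // leq_addr.
  rewrite [(l + _)%N]addnS deg_trajS e1 IH2; split; last by lia.
  apply/forallP => i; apply/forallP => j.
  apply: (@leq_trans (expo (traj (l + t)) j).+1); last exact: expo_trajS.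
  rewrite /= e1; case: eqP => _; first by rewrite addn1 ltnS; exact: minexpoP.
  by have /forallP/(_ i)/forallP/(_ j) := IH1.
have [d ld Dd] := D_unbounded (deg (traj l)).
have [b e] := bt (d - deg (traj l))%N.
have /negP := nj (l + (d - deg (traj l)))%N (leq_trans kl (leq_addr _ _)); apply.
by rewrite /jump b e subnKC.
Qed.

(** Any balanced index with nonzero coefficient in the expansion of V, or a nonzero coefficient of
    [vec] when V has small degree, forces a large minor. What remains is a multiple of the current
    vector at a jump, or of the companion of the exceptional index. *)
Lemma traj_lower (x : 'rV[laurent F]_n) k V :
  lnorm (x - point k) = expR (- (eps k)%:R) :> R -> V None != 0 ->
  (size (V None) < deg (traj k.+1))%N ->
  (size (V None) <= deg (traj k))%N || jump (traj k) ->
  expR (- (size (V None) + minexpo (traj k))%:R) <= lnorm (x - ratpoint V) :> R \/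
  exists l c, jump (traj l) /\ forall o, V o = c * vec (traj l) o.
Proof.
move=> xk V0 sV sVj; have gk := good_traj k.
have [c [b VE]] := state_span gk V.
(* A large minor keeps V farther from [point k] than x is, because [size (V None)] is below the next
   degree; [lnorm_far] then applies. *)
have big j : (deg (traj k) <= size (cross (vec (traj k)) V j) + minexpo (traj k))%N ->
    cross (vec (traj k)) V j != 0 ->
    expR (- (size (V None) + minexpo (traj k))%:R) <= lnorm (x - ratpoint V) :> R.
  move=> le c0; have V1 : (0 < size (V None))%N by rewrite size_poly_gt0.
  have ge : expR (- (size (V None) + minexpo (traj k))%:R) <=
      lnorm (ratpoint V - point k) :> R.
    rewrite lnormBC; apply: (@lnorm_cross_ge _ _ _ _ _ j _ (size (V None)).-1) c0.
    - exact: size_vec.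
    - by rewrite prednK.
    - by move: le V1; size_lia.
  apply: (le_trans ge); apply: lnorm_far; apply: lt_le_trans ge.
  by rewrite xk ltr_expR ltrN2 ltr_nat /eps; lia.
have comp i : b i != 0 -> (forall j, (expo (traj k) i <= (expo (traj k) j).+1)%N) ->
    expR (- (size (V None) + minexpo (traj k))%:R) <= lnorm (x - ratpoint V) :> R.
  move=> bi bal; have [j le] := size_cross_comb gk VE bi.
  have b1 : (0 < size (b i))%N by rewrite size_poly_gt0.
  apply: (big j); first by move: le b1 (bal (argmin (traj k))); rewrite /minexpo; size_lia.
  rewrite -size_poly_gt0.
  by move: le b1 (bal (argmin (traj k))) (expo_le_deg (traj k) i); size_lia.
have [jk|njk] := boolP (jump (traj k)).
  have [/existsP[i bi]|] := boolP [exists i, b i != 0].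
    left; apply: (comp i bi) => j.
    by move/andP: jk => [/forallP/(_ i)/forallP/(_ j)].
  rewrite negb_exists => /forallP b0; right; exists k, c; split => // o.
  by rewrite VE big1 ?addr0 // => i _; have /negPn/eqP-> := b0 i; rewrite mul0r.
rewrite (negbTE njk) orbF in sVj.
have [c0|c0] := eqVneq c 0; last first.
  left; have [j le] := size_cross_ge (argmin (traj k)) gk VE c0 sVj.
  apply: (big j); first exact: ltnW.
  rewrite -size_poly_gt0; have := expo_le_deg (traj k) (argmin (traj k)).
  by move: le; size_lia.
have [u [bal hu]] := traj_balance k.
have [/existsP[i /andP[iu bi]]|] := boolP [exists i, (i != u) && (b i != 0)].
  by left; apply: (comp i bi) => j; exact: bal.
rewrite negb_exists => /forallP bN.
have VEu o : V o = b u * com (traj k) u o.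
  rewrite VE c0 mul0r add0r (bigD1 u) //= big1 ?addr0 // => i iu.
  by have := bN i; rewrite iu /= negbK => /eqP->; rewrite mul0r.
case: hu => [hu|[l jl cl]].
  left; apply: (comp u) => //.
  by apply: contraNneq V0 => bu; rewrite VEu bu mul0r.
by right; exists l, (b u); split => // o; rewrite VEu cl.
Qed.

Lemma traj_exact : exists x : 'rV[laurent F]_n,
  [/\ forall j, labs (x 0 j) <= 1 :> R,
    forall N, exists (V : @ivec F n) d, [/\ (N <= d)%N, size (V None) = d.+1 &
      lnorm (x - ratpoint V) = expR (- (z d)%:R) :> R /\ D d] &
    forall V, V None != 0 ->
      (exists2 M, (n * M <= size (V None))%N &
        expR (- (size (V None) + M)%:R) <= lnorm (x - ratpoint V) :> R) \/
      exists (V' : @ivec F n) d c, [/\ size (V' None) = d.+1,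
        lnorm (x - ratpoint V') = expR (- (z d)%:R) :> R /\ D d &
        forall o, V o = c * V' o]].
Proof.
have [x xP] := traj_limit.
have jumpP l : jump (traj l) -> size (vec (traj l) None) = (deg (traj l)).+1 /\
    (lnorm (x - point l) = expR (- (z (deg (traj l)))%:R) :> R /\ D (deg (traj l))).
  move=> jl; rewrite xP eps_jump //; split; first exact: size_vec (good_traj l).
  by case/andP: jl.
exists x; split.
- have p0 : point 0 = 0.
    by apply/rowP => j; rewrite !mxE /= rmorph0 mul0r.
  move=> j; apply: (le_trans (labs_le_lnorm _ _ _)).
  by rewrite -[x]subr0 -p0 xP -[leRHS]expR0 ler_expR oppr_le0 ler0n.
- move=> N; have [l Nl jl] := jump_later N.
  have [sl xl] := jumpP _ jl; exists (vec (traj l)), (deg (traj l)); split => //.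
  exact: leq_trans (leq_deg_traj l).
move=> V V0.
have V1 : (0 < size (V None))%N by rewrite size_poly_gt0.
have ex : exists k, (size (V None) <= deg (traj k))%N.
  by exists (size (V None)); exact: leq_deg_traj.
(* The least such index is some k + 1, so [size (V None)] lies above deg (traj k) and at most at deg
   (traj k.+1). *)
case: (ex_minnP ex) => -[|k]; first by rewrite deg_init leqNgt V1.
move=> le /(_ k) kmin.
have {kmin} lt : (deg (traj k) < size (V None))%N.
  by rewrite ltnNge; apply/negP => /kmin; rewrite ltnn.
have fin m : (n * minexpo (traj m) <= size (V None))%N ->
    expR (- (size (V None) + minexpo (traj m))%:R) <= lnorm (x - ratpoint V) :> R \/
    (exists l c, jump (traj l) /\ forall o, V o = c * vec (traj l) o) ->
    (exists2 M, (n * M <= size (V None))%N &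
        expR (- (size (V None) + M)%:R) <= lnorm (x - ratpoint V) :> R) \/
      exists (V' : @ivec F n) d c, [/\ size (V' None) = d.+1,
        lnorm (x - ratpoint V') = expR (- (z d)%:R) :> R /\ D d &
        forall o, V o = c * V' o].
  move=> nm [ge|[l [c [jl Vc]]]]; [left|right]; first by exists (minexpo (traj m)).
  by have [sl xl] := jumpP _ jl; exists (vec (traj l)), (deg (traj l)), c.
move: le; rewrite leq_eqVlt => /predU1P[e|ltS].
  apply: (fin k.+1); first by rewrite e minexpo_deg.
  apply: traj_lower => //; last by rewrite e leqnn.
  by rewrite [deg (traj k.+2)]deg_trajS -e -addn1 leq_add2l step_size_gt0.
(* A size strictly between two consecutive degrees is possible only if step k is not a unit step,
   hence is a jump. *)
apply: (fin k); first exact: leq_trans (minexpo_deg _) (ltnW lt).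
apply: traj_lower => //; apply/orP; right; apply: contraLR ltS => njk.
by rewrite -leqNgt deg_trajS /step_size (negbTE njk) addn1.
Qed.

End Trajectory.

(** * Application to psi *)

Definition ivec_of {F : fieldType} {n : nat} (f : 'rV[{poly F}]_n) (g : {poly F}) :
  @ivec F n := fun o => if o is Some j then f 0 j else g.

Lemma ratvecE {F : fieldType} {n : nat} (f : 'rV[{poly F}]_n) (g : {poly F}) :
  ratvec f g = ratpoint (ivec_of f g).
Proof. by apply/rowP => j; rewrite !mxE. Qed.

Lemma ratpointE {F : fieldType} {n : nat} (V : @ivec F n) :
  ratpoint V = ratvec (\row_j V (Some j)) (V None).
Proof. by apply/rowP => j; rewrite !mxE. Qed.

Lemma infinite_set_unbounded (T : Type) (A : set T) (h : T -> nat) :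
  (forall N, exists2 t, A t & (N <= h t)%N) -> infinite_set A.
Proof.
move=> unb finA; have := finite_image h finA.
move=> /finite_seqP[s sE]; have [t At] := unb (\max_(k <- s) k).+1.
have : (h @` A) (h t) by exists t.
by rewrite sE /= => hs; rewrite ltnNge (leq_bigmax_seq _ hs).
Qed.

(** The little-o is used with constant e^-3; the resulting slack 3n absorbs the offsets between
    sizes and degrees. *)
Lemma littleo_pabs_bound (R : realType) (F : fieldType) (n : nat) (psi : R -> R) :
  (0 < n)%N ->
  (psi : R -> R^o) =o_ (pabs_oo R F) (fun r : R => r `^ (- (n.+1%:R / n%:R)) : R^o) ->
  exists d0, forall d N, (d0 <= d)%N -> (n * N <= n.+1 * d + 3 * n)%N ->
    psi (expR d%:R) <= expR (- N%:R).
Proof.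
move=> n0 /eqoP /(_ (expR (- 3%:R))) /(_ (expR_gt0 _)) [A [Areal AP]].
exists (Num.truncn A).+1 => d N dA nN.
have Xd : 'X^d != 0 :> {poly F} by rewrite -size_poly_gt0 size_polyXn.
have rg : range (@pabs R F) (expR d%:R).
  by exists 'X^d => //; rewrite /pabs labs_poly // size_polyXn.
have Ad : A < expR d%:R.
  apply: (lt_le_trans (truncnS_gt _)); apply: (@le_trans _ _ d%:R).
    by rewrite ler_nat.
  by apply: le_trans (expR_ge1Dx _); rewrite lerDr.
have := AP _ Ad rg; rewrite /= => H.
apply: (le_trans (ler_norm _)); apply: (le_trans H).
rewrite ger0_norm ?powR_ge0 // -expRM -expRD ler_expR.
have n0' : 0 < n%:R :> R by rewrite ltr0n.
rewrite lerNr opprD opprK mulrN opprK.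
rewrite -(ler_pM2l n0') mulrDr mulrCA [_ * (_ / _)]mulrCA divff ?gt_eqF // mulr1.
rewrite -!natrM -natrD ler_nat; lia.
Qed.

Unset Implicit Arguments.
Set Strict Implicit.

Theorem theorem1p4 (R : realType) (F : finFieldType) (n : nat) (n_ge1 : (1 <= n)%N)
  (psi : R -> R)
  (psi_gt0 : forall r : R, 0 < r -> 0 < psi r)
  (psi_nonincr : forall r s : R, 0 < r -> r <= s -> psi s <= psi r)
  (psi_small :
    (psi : R -> R^o) =o_ (pabs_oo R F) (fun r : R => r `^ (- (n.+1%:R / n%:R)) : R^o))
  (lambda_fin : (lambda_ F psi < +oo)%E)
  (psi_value : attains_values F psi) :
  Exact F n psi !=set0.
Proof.
have [d0 psi_le] := littleo_pabs_bound n_ge1 psi_small.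
pose P d (m : nat) := psi (expR d%:R) = expR (- m%:R).
pose D d := (d0 <= d)%N && `[< exists m, P d m >].
pose z d := xget 0%N [set m | P d m].
have zP d : D d -> psi (expR d%:R) = expR (- (z d)%:R).
  move=> /andP[_ /asboolP[m Pm]]; rewrite /z.
  by case: xgetP => [m' _ //|/(_ m)].
(* A value of psi in the value group is a power of e, and [psi_le] with N = 0 bounds it by 1, so its
   exponent is minus a natural number. *)
have D_unbounded N : exists2 d, (N <= d)%N & D d.
  have [g [g0 ge [w wE]]] := psi_value (expR (maxn N d0)%:R).
  move: ge wE; rewrite {1 2}/pabs labs_poly // ler_expR ler_nat geq_max.
  set d := (size g).-1 => /andP[Nd d0d] wE; exists d => //.
  rewrite /D d0d /=; apply/asboolP; exists `|ldeg w|%N; rewrite /P wE.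
  have : 0 < labs w :> R by rewrite -wE psi_gt0 ?expR_gt0.
  have : labs w <= expR (- 0%:R) :> R by rewrite -wE psi_le // muln0.
  rewrite /labs; case: eqP => _; rewrite ?ltxx // oppr0 ler_expR => le _.
  have : ldeg w <= 0 by rewrite -(ler_int R).
  move=> w0; rewrite -[(`|ldeg w|%N)%:R]/((`|ldeg w|%N)%:~R) -mulrNz.
  by congr (expR _%:~R); lia.
have z_large d M : D d -> (n * M <= d)%N -> (d + M < z d)%N.
  move=> Dd nM; have /andP[d0d _] := Dd.
  have : psi (expR d%:R) <= expR (- (d + M).+1%:R) by apply: psi_le => //; lia.
  by rewrite zP // ler_expR lerN2 ler_nat.
have [x [x1 xinf xlow]] := @traj_exact R F n (Ordinal n_ge1) D z D_unbounded z_large.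
exists x; split => //.
- apply: (@infinite_set_unbounded _ _
    (fun fg : 'rV[{poly F}]_n * {poly F} => size fg.2)) => N.
  have [V [d [Nd sV [xV Dd]]]] := xinf N.
  have V0 : V None != 0 by rewrite -size_poly_gt0 sV.
  exists (\row_j V (Some j), V None) => /=; last by rewrite sV ltnW.
  by rewrite -ratpointE xV /pabs labs_poly // sV /= zP.
exists 'X^d0 => f g g0; rewrite ratvecE.
have Xd : 'X^d0 != 0 :> {poly F} by rewrite -size_poly_gt0 size_polyXn.
rewrite /pabs !labs_poly // size_polyXn ler_expR ler_nat /= => d0g.
have g1 : (0 < size g)%N by rewrite size_poly_gt0.
have [[M nM ge]|[V [d [c [sV [xV Dd] gV]]]]] := xlow (ivec_of f g) g0.
  (* With d = deg g, n M <= d + 1 gives n (d + 1 + M) <= (n+1) d + n + 1, within the slack 3n. *)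
  apply: le_trans ge => /=; apply: psi_le => //.
  by move: nM g1 => /=; case: (size g) => //= s; lia.
have V0 : V None != 0 by rewrite -size_poly_gt0 sV.
(* Here f/g is a jump point in unreduced form, so |g| is at least the height of the reduced vector
   and monotonicity of psi suffices. *)
rewrite (ratpoint_scale _ gV) // xV -zP //; apply: psi_nonincr; first exact: expR_gt0.
rewrite ler_expR ler_nat; have gE : g = c * V None := gV None.
have c0 : c != 0 by apply: contraNneq g0 => c0; rewrite gE c0 mul0r.
have c1 : (0 < size c)%N by rewrite size_poly_gt0.
by rewrite gE (size_mul c0 V0) sV; move: c1; size_lia.
Qed.
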